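(* Let $a_0,a_1,a_2,b_0,b_1\in\mathbb R$ with $a_1\le a_2$, and let $p(x,y)=a(x)+b(x)y+y^2$, where $a(x)=a_0(x+a_1)(x+a_2)$ and $b(x)=b_0(x+b_1)$. Assume that $p(m,n)>0$ for every $m,n\in\mathbb Z_+$. Then $\left\{\frac{1}{p(m,n)}\right\}_{m,n\in\mathbb Z_+}$ is a joint completely monotone net if and only if $a_1,a_2,b_0,b_1>0$, $b_0^2\ge4a_0$, and $$a_0(a_2-a_1)^2\le b_0^2(b_1-a_1)(a_2-b_1).$$
   Context: $\mathbb Z_+$ denotes the nonnegative integers. For a net $\{a_\alpha\}_{\alpha\in\mathbb Z_+^n}$ of reals and $j=1,\dots,n$, $\triangle_ja_\alpha=a_{\alpha+\varepsilon_j}-a_\alpha$, where $\varepsilon_j$ has $j$th entry $1$ and $0$ elsewhere; $\triangle^\beta=\prod_j\triangle_j^{\beta_j}$ and $|\beta|=\beta_1+\cdots+\beta_n$. The net is joint completely monotone if $(-1)^{|\beta|}\triangle^\beta a_\alpha\ge0$ for all $\alpha,\beta\in\mathbb Z_+^n$. *)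

(* Defs.v *)
From mathcomp Require Import all_boot all_order all_algebra.
From mathcomp Require Import reals.

Set Implicit Arguments.
Unset Strict Implicit.
Unset Printing Implicit Defensive.

Import Order.TTheory GRing.Theory Num.Theory.

Local Open Scope ring_scope.

Definition multiindex (n : nat) := {ffun 'I_n -> nat}.

Definition unit_mi (n : nat) (j : 'I_n) : multiindex n := [ffun i => nat_of_bool (i == j)].

Definition add_mi (n : nat) (alpha beta : multiindex n) : multiindex n :=
  [ffun i => (alpha i + beta i)%N].

Definition deg_mi (n : nat) (beta : multiindex n) : nat := (\sum_(j < n) beta j)%N.

Definition net (R : realType) (n : nat) := multiindex n -> R.

Definition fdiff (R : realType) (n : nat) (j : 'I_n) (a : net R n) : net R n :=
  fun alpha => a (add_mi alpha (unit_mi j)) - a alpha.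

(* The product of operators is composition; the operators [fdiff j] commute, so
   the order of the factors is immaterial. *)
Definition mfdiff (R : realType) (n : nat) (beta : multiindex n) : net R n -> net R n :=
  \big[comp/id]_(j < n) iter (beta j) (@fdiff R n j).

Definition joint_completely_monotone (R : realType) (n : nat) (a : net R n) : Prop :=
  forall alpha beta : multiindex n, 0 <= (-1) ^+ deg_mi beta * mfdiff beta a alpha.

Section Quadratic.
Variables (R : realType) (a0 a1 a2 b0 b1 : R).

Definition acoef (x : R) : R := a0 * (x + a1) * (x + a2).

Definition bcoef (x : R) : R := b0 * (x + b1).

Definition quad_p (x y : R) : R := acoef x + bcoef x * y + y ^+ 2.

End Quadratic.

Definition net2 (R : realType) (f : nat -> nat -> R) : net R 2 :=
  fun alpha => f (alpha ord0) (alpha ord_max).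

(* Main.v *)
Require Import Defs.
From mathcomp Require Import all_boot all_order all_algebra.
From mathcomp Require Import reals.
From mathcomp Require Import boolp classical_sets topology normedtype sequences.
From mathcomp Require Import ring lra.

Set Implicit Arguments.
Unset Strict Implicit.
Unset Printing Implicit Defensive.

Import Order.TTheory GRing.Theory Num.Theory.
Import numFieldNormedType.Exports.

Local Open Scope ring_scope.

(** Write [a], [b] for the coefficients of [p] as a polynomial in [y], and
    [D = b^2 - 4a] for its discriminant, itself a quadratic [Ax^2 + Bx + C].
    Its own discriminant is
      [B^2 - 4AC = 16 a0 (a0 (a2 - a1)^2 - b0^2 (b1 - a1) (a2 - b1))],
    and [a0 > 0] because [p(m,0) > 0].  So the last two conditions say that
    [A >= 0] and [B^2 <= 4AC], that is, essentially, that [sqrt D] is convex.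

    Sufficiency.  Under these conditions [D = (sx + e)^2 + 4k] with
    [s = sqrt A] and [k >= 0], hence [p = L1 L2 - k] where [L1], [L2] are
    affine with nonnegative coefficients at [x], [y] (as [s <= b0]) and positive
    on the lattice (their product and their sum are).  The inverse of such a
    form is completely monotone, complete monotonicity survives products and
    limits, and [1/p = \sum_j k^j / (L1 L2)^(j+1)] (lemmas
    [cm_upto_inv_linear], [cm_uptoM], [cm_upto_inv_sub]).

    Necessity, rows.  Let [q(y) = c + by + y^2] be positive on the naturals with
    [1/q] completely monotone, and let [u_N >= 0] be the [N]th backward
    difference of [1/q] at [0].  Then [z_N = N (u_(N-1) - u_N) / u_N] obeys a
    discrete form of the Riccati equation [t z' = z^2 - bz + c].  If
    the right-hand side dominated a multiple of [z^2] for [z >= 0], then [1/z]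
    would decrease at least like a harmonic sum and become negative.  Therefore
    [b > 0] and [b^2 >= 4c] ([cm_seq_inv_quadratic]).  The column [n = 0] gives
    [a1, a2 > 0]; the rows give [b(m) > 0] and [D(m) >= 0], whence
    [b0, b1 > 0] and [A >= 0].

    Necessity, the discriminant of [D].  Suppose [B^2 > 4AC].  Far out, [D > 0]
    and [p(m,y) = (y + r(m)) (y + s(m))] with [0 < r(m) < s(m)].  The [N]th
    backward difference in [y] of [1/p(m,y)] at [y = 0] is, up to constants
    depending on [m], the beta value [B(r(m), N+1)], which behaves like
    [N^(- r(m))].  The difference itself is completely monotone, hence
    log-convex, in [m]; letting [N] grow, [r(m) + r(m+2) <= 2 r(m+1)] ([small_root_concave]).  As [b] is
    affine, this is convexity of [sqrt D] at three consecutive points, which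
    after squaring twice is exactly [B^2 <= 4AC]. *)

(** * Backward differences and completely monotone sequences *)

Section Sequences.
Variable R : realType.
Implicit Types (f c : nat -> R) (k n N : nat).

Definition bdiff f : nat -> R := fun n => f n - f n.+1.

Definition cm_seq f : Prop := forall k n, 0 <= iter k bdiff f n.

Lemma iter_bdiff_shift N f n :
  iter N bdiff (fun n => f n.+1) n = iter N bdiff f n.+1.
Proof. by elim: N n => //= N IH n; rewrite /bdiff !IH. Qed.

Lemma iter_bdiffD N f g n :
  iter N bdiff (fun n => f n + g n) n = iter N bdiff f n + iter N bdiff g n.
Proof. by elim: N n => //= N IH n; rewrite /bdiff !IH; ring. Qed.

Lemma iter_bdiffZ N a f n :
  iter N bdiff (fun n => a * f n) n = a * iter N bdiff f n.
Proof. by elim: N n => //= N IH n; rewrite /bdiff !IH; ring. Qed.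

Lemma iter_bdiff_cst N a n : iter N.+1 bdiff (fun=> a) n = 0.
Proof.
by elim: N n => [|N IH] n; [rewrite /= /bdiff subrr|rewrite iterS /bdiff !IH subrr].
Qed.

(** Leibniz rule for multiplication by the identity: it turns the functional
    equation of a rational sequence into a recurrence between its differences
    of successive orders. *)
Lemma iter_bdiffM_nat N f n :
  iter N bdiff (fun n => n%:R * f n) n
    = (n + N)%:R * iter N bdiff f n - N%:R * iter N.-1 bdiff f n.
Proof.
elim: N n => [|N IH] n; first by rewrite addn0 mul0r subr0.
rewrite iterS /bdiff !IH; case: N {IH} => [|N].
  by rewrite /= /bdiff addn1 addn0 -natr1; ring.
rewrite -[N.+1.-1]/N -[N.+2.-1]/N.+1 !(iterS N.+1) !(iterS N).
move: (iter N bdiff f) => g; rewrite /bdiff addSn !addnS -!natr1 natrD; ring.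
Qed.

Lemma cm_seq_bdiff c : cm_seq c -> cm_seq (bdiff c).
Proof. by move=> cc k n; rewrite -iterSr. Qed.

Lemma cm_seq_shift c : cm_seq c -> cm_seq (fun n => c n.+1).
Proof. by move=> cc k n; rewrite iter_bdiff_shift. Qed.

(** The expression is the value of the moment functional [t^i |-> c i] on the
    Bernstein sum of [(a - j)^2], that is
    [\sum_(j <= k) (a - j)^2 'C(k, j) t^j (1 - t)^(k - j)]: the second moment
    about [a] of a binomial variable.  Splitting by [1 = (1 - t) + t], that is,
    by the outcome of one trial, gives the induction on [k]. *)
Lemma cm_seq_variance k c (a : R) : cm_seq c ->
  0 <= a ^+ 2 * c 0 - 2 * a * k%:R * c 1 + k%:R * (k%:R - 1) * c 2 + k%:R * c 1.
Proof.
elim: k c a => [|k IH] c a cc.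
  have := mulr_ge0 (sqr_ge0 a) (cc 0 0); rewrite /=; lra.
have := addr_ge0 (IH _ a (cm_seq_bdiff cc)) (IH _ (a - 1) (cm_seq_shift cc)).
rewrite /bdiff -(natr1 k).
set l := (X in 0 <= X) => H; set r := (X in 0 <= X).
by have -> : r = l by rewrite /l /r; ring.
Qed.

(** With [a = k * c 1 / c 0] in [cm_seq_variance], division by [k^2] leaves the
    Cauchy-Schwarz inequality up to an error of order [1 / k]. *)
Lemma cm_seq_log_convex c : cm_seq c -> 0 < c 0 -> c 1 ^+ 2 <= c 0 * c 2.
Proof.
move=> cc c0; rewrite leNgt; apply/negP => lt.
have e0 : 0 < c 1 ^+ 2 - c 0 * c 2 by rewrite subr_gt0.
set e := c 1 ^+ 2 - c 0 * c 2 in e0 *.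
pose k := (Num.bound `|c 0 * (c 1 - c 2) / e|).+1.
have k0 : 0 < k%:R :> R by rewrite ltr0n.
have kb : c 0 * (c 1 - c 2) < k%:R * e.
  rewrite -ltr_pdivrMr //; apply: le_lt_trans (ler_norm _) _.
  by apply: lt_le_trans (archi_boundP (normr_ge0 _)) _; rewrite ler_nat.
have := cm_seq_variance k (k%:R * c 1 / c 0) cc.
have -> : (k%:R * c 1 / c 0) ^+ 2 * c 0 - 2 * (k%:R * c 1 / c 0) * k%:R * c 1 +
    k%:R * (k%:R - 1) * c 2 + k%:R * c 1 =
    (k%:R / c 0) * (c 0 * (c 1 - c 2) - k%:R * e).
  by rewrite /e; field; lra.
by rewrite pmulr_rge0 ?divr_gt0 // subr_ge0 leNgt kb.
Qed.

Lemma harmonic_growth_unbounded (x : nat -> R) (e M : R) K : 0 < e ->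
  (forall k, (K <= k)%N -> x k + e / k.+1%:R <= x k.+1) ->
  (forall k, x k <= M) -> False.
Proof.
move=> e0 xS xM; apply: (@dvg_harmonic R).
have ih k : 0 < k.+1%:R^-1 :> R by rewrite invr_gt0 ltr0n.
have s0 n : 0 <= series (@harmonic R) n.
  by rewrite seriesEord; apply: sumr_ge0 => i _; apply: harmonic_ge0.
have bound n : series (@harmonic R) (n + K)%N
    <= (x (n + K)%N - x K) / e + series (@harmonic R) K.
  elim: n => [|n IH]; first by rewrite add0n subrr mul0r add0r.
  rewrite addSn seriesSr.
  have -> : x (n + K).+1 = (x (n + K).+1 - x (n + K)%N - e / (n + K).+1%:R)
      + x (n + K)%N + e / (n + K).+1%:R by ring.
  have h : 0 <= (x (n + K).+1 - x (n + K)%N - e / (n + K).+1%:R) / e.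
    by rewrite divr_ge0 ?(ltW e0) // subr_ge0 lerBrDl xS // leq_addl.
  set y := (X in 0 <= X / e) in h *.
  have -> : (y + x (n + K)%N + e / (n + K).+1%:R - x K) / e =
     y / e + (x (n + K)%N - x K) / e + harmonic (n + K)%N.
    rewrite /harmonic /=.
    move: (ltr0Sn R (n + K)) y {h}; move: (_.+1%:R) => z z0 y.
    by field; rewrite !gt_eqF.
  move: IH h; lra.
have mono : {homo series (@harmonic R) : n m / (n <= m)%N >-> n <= m}.
  apply/nondecreasing_seqP => n; rewrite seriesSr lerDl; exact: harmonic_ge0.
apply: nondecreasing_is_cvgn => //.
exists ((M - x K) / e + series (@harmonic R) K) => _ [n _ <-].
apply: le_trans (mono _ (n + K)%N (leq_addr _ _)) _.
apply: le_trans (bound n) _.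
by rewrite lerD2r ler_pM2r ?invr_gt0 // lerD2r xM.
Qed.

(** * Inverses of monic quadratics: the discrete Riccati argument *)

Section InvQuadratic.
Variables b c : R.
Let q n : R := c + b * n%:R + n%:R ^+ 2.
Hypothesis q_gt0 : forall n, 0 < q n.
Let f n := (q n)^-1.
Let u N := iter N bdiff f 0.
Let d N := N%:R * (u N.-1 - u N).

(** The [N.+1]th difference of the constant [f * q = 1]. *)
Lemma inv_quadratic_rec N : (N.+1%:R + b) * d N.+1 = N.+1%:R * d N + c * u N.+1.
Proof.
have e : (fun n => c * f n + (b * (n%:R * f n) + n%:R * (n%:R * f n))) = (fun=> 1).
  apply: funext => n; transitivity (q n * f n); last by rewrite divff ?gt_eqF.
  by move: (f n) => fn; rewrite /q; ring.
have := iter_bdiff_cst N 1 0; rewrite -e !iter_bdiffD !iter_bdiffZ.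
rewrite (iter_bdiffM_nat N.+1 (fun n => n%:R * f n)) !iter_bdiffM_nat /=.
rewrite /d /= -/(u N) -/(u N.-1) !add0n.
rewrite -[bdiff _ _]/(u N.+1) => h.
suff : (N.+1%:R + b) * (N.+1%:R * (u N - u N.+1))
    - (N.+1%:R * (N%:R * (u N.-1 - u N)) + c * u N.+1) = 0
  by move/eqP; rewrite subr_eq0 => /eqP.
by rewrite -oppr0 -h; ring.
Qed.

(** In terms of [z = d / u], the recurrence is a discretization of
    [t z' = z^2 - bz + c].  A lower bound [e z^2] for the right-hand side makes
    [1 / z = u / d] decrease by at least [e / (N + b)] at step [N], which cannot
    go on since [u] and [d] stay positive. *)
Lemma cm_seq_inv_quadratic_not_coercive e :
  cm_seq f -> 0 < e ->
  ~ (forall s t, 0 <= s -> 0 <= t -> e * t ^+ 2 <= t ^+ 2 - b * s * t + c * s ^+ 2).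
Proof.
move=> cf e0 coer.
have c0 : 0 < c by have := q_gt0 0; rewrite /q; lra.
have u0 N : 0 <= u N by exact: cf.
have dE N : d N.+1 = N.+1%:R * (u N - u N.+1) by [].
have d0 N : 0 <= d N.
  case: N => [|N]; first by rewrite /d mul0r.
  by rewrite dE mulr_ge0 // /u iterS /bdiff opprB addrCA subrr addr0; exact: cf.
have uN N : u N.+1 <= u N.
  by move: (d0 N.+1); rewrite dE pmulr_rge0 ?ltr0n // subr_ge0.
have rec := inv_quadratic_rec.
(* If [u] vanished, it would vanish from there on, and the recurrence would
   force the last nonzero difference to be zero. *)
have up N : 0 < u N.
  elim: N => [|N IH]; first by rewrite /u /= /f invr_gt0.
  rewrite lt_def u0 andbT; apply/eqP => uz.
  have uz2 : u N.+2 = 0 by apply/eqP; rewrite eq_le u0 -uz uN.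
  have := rec N.+1; rewrite uz2 (dE N.+1) uz uz2 subrr !mulr0 addr0 dE uz subr0.
  by move/esym/eqP; rewrite !mulf_eq0 !pnatr_eq0 /= gt_eqF.
have dn N : 0 < d N.+1 /\ 0 < N.+1%:R + b.
  have h : 0 < (N.+1%:R + b) * d N.+1.
    by rewrite rec ltr_wpDl ?mulr_gt0 // mulr_ge0.
  have h2 : 0 < d N.+1.
    by rewrite lt_def d0 andbT; apply: contraTneq h => ->; rewrite mulr0 ltxx.
  by split=> //; rewrite -(pmulr_lgt0 _ h2).
pose v N := - (u N.+1 / d N.+1).
apply: (@harmonic_growth_unbounded v (e / (2 + `|b|)) 0 0).
- by rewrite divr_gt0 // ltr_wpDr.
- move=> k _; rewrite /v.
  have [dk kb] := dn k; have [dk1 kb1] := dn k.+1.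
  have h := rec k.+1; have h2 := dE k.+1.
  have := coer (u k.+2) (d k.+2) (u0 _) (d0 _).
  move: (up k.+1) (up k.+2) dk dk1 h h2 kb1.
  set U := u k.+1; set U' := u k.+2; set D := d k.+1; set D' := d k.+2.
  move=> U_gt0 U'_gt0 D_gt0 D'_gt0 h h2 kb1 co.
  set n := k.+2%:R in h h2 kb1.
  have n0 : 0 < n by rewrite ltr0n.
  have nE : n = 1 + k.+1%:R by rewrite /n -(natr1 k.+1) addrC.
  clearbody n U U' D D'.
  have num : e * D' ^+ 2 <= n * (U * D' - U' * D).
    have -> : n * (U * D' - U' * D) = D' ^+ 2 - b * U' * D' + c * U' ^+ 2.
      have -> : n * (U * D' - U' * D) = n * U * D' - U' * (n * D) by ring.
      have -> : n * D = (n + b) * D' - c * U' by rewrite h; ring.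
      have -> : n * U = D' + n * U' by rewrite h2; ring.
      ring.
    exact: co.
  have nD : n * D <= (n + b) * D' by rewrite h lerDl mulr_ge0 // ltW.
  have main : e / (n + b) <= U / D - U' / D'.
    have -> : U / D - U' / D' = n * (U * D' - U' * D) / (n * D * D').
      by field; rewrite !gt_eqF.
    rewrite ler_pdivlMr ?mulr_gt0 //; apply: le_trans num.
    rewrite mulrAC ler_pdivrMr //.
    have -> : e * (n * D * D') = e * D' * (n * D) by ring.
    have -> : e * D' ^+ 2 * (n + b) = e * D' * ((n + b) * D') by ring.
    by rewrite ler_wpM2l // mulr_ge0 // ltW.
  have -> : e / (2 + `|b|) / k.+1%:R = e / ((2 + `|b|) * k.+1%:R).
    by rewrite invfM mulrA.
  have cmp : n + b <= (2 + `|b|) * k.+1%:R.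
    rewrite nE; have k1 : 1 <= k.+1%:R :> R by rewrite ler1n.
    have := ler_norm b; have := normr_ge0 b.
    by move: k1; move: (k.+1%:R : R) => K ? ? ?; nra.
  have : e / ((2 + `|b|) * k.+1%:R) <= e / (n + b).
    by rewrite ler_pM2l // lef_pV2 // posrE //; apply: lt_le_trans cmp.
  move=> /le_trans/(_ main); move: (e / _) (U / D) (U' / D') => X Y Z; lra.
- by move=> k; rewrite oppr_le0 divr_ge0.
Qed.

(** If either conclusion fails, [t^2 - b s t + c s^2] dominates a multiple of
    [t^2] on the positive quadrant: trivially if [b <= 0], and by completing the
    square if [b^2 < 4c]. *)
Lemma cm_seq_inv_quadratic : cm_seq f -> 0 < b /\ 4 * c <= b ^+ 2.
Proof.
move=> cf.
have c0 : 0 < c by have := q_gt0 0; rewrite /q; lra.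
have b0 : 0 < b.
  rewrite ltNge; apply/negP => b0.
  apply: (cm_seq_inv_quadratic_not_coercive cf ltr01) => s t s0 t0.
  have := mulr_ge0 (mulr_ge0 (_ : 0 <= - b) s0) t0; rewrite oppr_ge0 => /(_ b0).
  have := mulr_ge0 (ltW c0) (sqr_ge0 s); lra.
split=> //; rewrite leNgt; apply/negP => lt.
have e0 : 0 < 1 - b ^+ 2 / (4 * c).
  by rewrite subr_gt0 ltr_pdivrMr ?mul1r // mulr_gt0.
apply: (cm_seq_inv_quadratic_not_coercive cf e0) => s t s0 t0.
rewrite -subr_ge0.
have -> : t ^+ 2 - b * s * t + c * s ^+ 2 - (1 - b ^+ 2 / (4 * c)) * t ^+ 2
  = (b * t / 2 - c * s) ^+ 2 / c by field; lra.
by rewrite divr_ge0 ?sqr_ge0 // ltW.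
Qed.

End InvQuadratic.

(** * Two negative roots: growth of the differences *)

(** Euler's [B(r, N+1) = N! / (r (r+1) ... (r+N))], by the recurrence
    [euler_betaS]. *)
Definition euler_beta (r : R) N : R := iter N bdiff (fun n => (r + n%:R)^-1) 0.

Lemma euler_beta0 r : euler_beta r 0 = r^-1.
Proof. by rewrite /euler_beta /= addr0. Qed.

Lemma euler_betaS r N : 0 < r ->
  euler_beta r N.+1 = euler_beta r N * (N.+1%:R / (r + N.+1%:R)).
Proof.
move=> r0; pose h n := (r + n%:R)^-1.
have e : (fun n => r * h n + n%:R * h n) = (fun=> 1).
  by apply: funext => n; rewrite -mulrDl mulfV // gt_eqF // ltr_wpDr.
have := iter_bdiff_cst N (1 : R) 0.
rewrite -e iter_bdiffD iter_bdiffZ iter_bdiffM_nat add0n.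
rewrite -/(euler_beta r N.+1) -/(euler_beta r N) => H.
rewrite mulrA; apply/(canRL (mulfK _)); first by rewrite gt_eqF // ltr_wpDr.
by apply/eqP; rewrite -subr_eq0 -H; apply/eqP; ring.
Qed.

Lemma euler_beta_gt0 r N : 0 < r -> 0 < euler_beta r N.
Proof.
move=> r0; elim: N => [|N IH]; first by rewrite euler_beta0 invr_gt0.
by rewrite euler_betaS // mulr_gt0 // divr_gt0 // ltr_wpDl // ltW.
Qed.

Lemma euler_beta_compare r s N : 0 < r -> r <= s ->
  s * euler_beta s N <= r * euler_beta r N.
Proof.
move=> r0 rs; have s0 := lt_le_trans r0 rs.
elim: N => [|N IH]; first by rewrite !euler_beta0 !mulfV // gt_eqF.
rewrite !euler_betaS // !mulrA ler_pM ?divr_ge0 ?mulr_ge0 //.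
- exact: ltW.
- by rewrite ltW // euler_beta_gt0.
- by rewrite invr_ge0 addr_ge0 // ltW.
- by rewrite ler_pM // mulr_ge0 ?ltW // euler_beta_gt0.
- by rewrite lef_pV2 ?posrE ?lerD2r // ltr_wpDl // ltW.
Qed.

(** Partial fractions express the difference as
    [(B(r, N+1) - B(s, N+1)) / (s - r)], and the pole nearer to the origin
    dominates, uniformly in [N]. *)
Lemma iter_bdiff_inv_prod r s N : 0 < r -> r < s ->
  euler_beta r N / s
    <= iter N bdiff (fun n => ((n%:R + r) * (n%:R + s))^-1) 0
    <= euler_beta r N / (s - r).
Proof.
move=> r0 rs; set U := iter N _ _ _; have s0 := lt_trans r0 rs.
have d0 : 0 < s - r by rewrite subr_gt0.
have -> : U = (euler_beta r N + -1 * euler_beta s N) / (s - r).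
  rewrite [RHS]mulrC /euler_beta -iter_bdiffZ -iter_bdiffD -iter_bdiffZ /U.
  congr (iter N bdiff _ 0).
  apply: funext => n.
  have hr : 0 < r + n%:R by rewrite ltr_wpDr.
  have hs : 0 < s + n%:R by rewrite ltr_wpDr.
  by field; rewrite !gt_eqF //= addrC.
have c0 := euler_beta_gt0 N r0; have c1 := euler_beta_gt0 N s0.
have := euler_beta_compare N r0 (ltW rs).
move: (euler_beta r N) (euler_beta s N) c0 c1 => x y x0 y0 xy.
apply/andP; split.
  rewrite ler_pdivlMr // mulrAC ler_pdivrMr //; nra.
by rewrite ler_pM2r ?invr_gt0 //; lra.
Qed.

(** The quotient is a product of factors
    [(r0 + n) (r2 + n) / (r1 + n)^2 = 1 + (r0 + r2 - 2 r1) / n + O(1 / n^2)],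
    which diverges. *)
Lemma euler_beta_ratio_unbounded r0 r1 r2 (M : R) :
  0 < r0 -> 0 < r1 -> 0 < r2 -> 2 * r1 < r0 + r2 ->
  ~ (forall N, euler_beta r1 N ^+ 2 <= M * (euler_beta r0 N * euler_beta r2 N)).
Proof.
move=> p0 p1 p2 lt bnd.
pose x N := euler_beta r1 N ^+ 2 / (euler_beta r0 N * euler_beta r2 N).
have x_gt0 N : 0 < x N by rewrite divr_gt0 ?exprn_gt0 ?mulr_gt0 ?euler_beta_gt0.
have xM N : x N <= M by rewrite ler_pdivrMr ?bnd // mulr_gt0 ?euler_beta_gt0.
pose g N : R := (r0 + N.+1%:R) * (r2 + N.+1%:R) / (r1 + N.+1%:R) ^+ 2.
have xS N : x N.+1 = x N * g N.
  rewrite /x !euler_betaS // /g.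
  have := euler_beta_gt0 N p0; have := euler_beta_gt0 N p1.
  have := euler_beta_gt0 N p2.
  move: (ltr0Sn R N).
  move: (euler_beta r0 N) (euler_beta r1 N) (euler_beta r2 N) (N.+1%:R : R).
  move=> u v w n *; field.
  by rewrite !gt_eqF //= ltr_wpDl // ltW.
pose e := (r0 + r2 - 2 * r1) / 2.
have e0 : 0 < e by rewrite divr_gt0 // subr_gt0.
pose K := Num.bound (r1 ^+ 2 / e).
pose c := e / (1 + r1) ^+ 2.
have r10 : 0 < 1 + r1 by rewrite ltr_wpDr // ltW.
have c0 : 0 < c by rewrite divr_gt0 // exprn_gt0.
(* Half of the first-order term of the factor, [e n] out of [2 e n], absorbs the
   constant [r1^2]; the other half is at least [c / n] after division by
   [(r1 + n)^2 <= ((1 + r1) n)^2]. *)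
have gK N : (K <= N)%N -> 1 + c / N.+1%:R <= g N.
  move=> KN.
  have big : r1 ^+ 2 <= e * N.+1%:R.
    rewrite -ler_pdivrMl // mulrC.
    apply: ltW; apply: lt_le_trans (archi_boundP _) _.
      by rewrite divr_ge0 ?sqr_ge0 // ltW.
    by rewrite ler_nat leqW.
  have n1 : 1 <= N.+1%:R :> R by rewrite ler1n.
  rewrite /g /c; move: (N.+1%:R : R) n1 big => n n1 big.
  have n0 : 0 < n by lra.
  have rn0 : 0 < r1 + n by lra.
  rewrite ler_pdivlMr ?exprn_gt0 // mulrDl mul1r -lerBrDl.
  apply: (@le_trans _ _ (e * n)).
    have -> : e / (1 + r1) ^+ 2 / n * (r1 + n) ^+ 2
        = e * ((r1 + n) ^+ 2 / ((1 + r1) ^+ 2 * n)).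
      by field; rewrite !gt_eqF.
    rewrite ler_pM2l // ler_pdivrMr ?mulr_gt0 ?exprn_gt0 //.
    have -> : n * ((1 + r1) ^+ 2 * n) = (n + r1 * n) ^+ 2 by ring.
    rewrite ler_sqr ?nnegrE; nra.
  have : r0 + r2 = 2 * r1 + 2 * e by rewrite /e; field.
  nra.
have mono N : (K <= N)%N -> x K <= x N.
  elim: N => [|N IH]; first by rewrite leqn0 => /eqP ->.
  rewrite leq_eqVlt => /predU1P[->//|]; rewrite ltnS => KN.
  apply: le_trans (IH KN) _; rewrite xS ler_peMr ?(ltW (x_gt0 _)) //.
  by apply: le_trans (gK N KN); rewrite lerDl divr_ge0 // ltW.
apply: (@harmonic_growth_unbounded x (x K * c) M K) => //; first exact: mulr_gt0.
move=> N KN; rewrite xS -mulrA.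
apply: (@le_trans _ _ (x N * (1 + c / N.+1%:R))); last by rewrite ler_pM2l // gK.
by rewrite mulrDr mulr1 lerD2l ler_wpM2r ?mono // divr_ge0 // ltW.
Qed.

(** By [iter_bdiff_inv_prod], log-convexity in [m] of the [N]th difference is,
    up to a constant independent of [N], the inequality between beta values
    that [euler_beta_ratio_unbounded] excludes when [r 0 + r 2 > 2 * r 1]. *)
Lemma small_root_concave (r s : nat -> R) :
  (forall m, 0 < r m < s m) ->
  (forall N, cm_seq (fun m => iter N bdiff
     (fun n => ((n%:R + r m) * (n%:R + s m))^-1) 0)) ->
  r 0 + r 2 <= 2 * r 1.
Proof.
move=> rs cm; rewrite leNgt; apply/negP => lt.
have r_gt0 m : 0 < r m by have /andP[] := rs m.
have s_gt0 m : 0 < s m by have /andP[? ?] := rs m; exact: lt_trans (r_gt0 m) _.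
have d_gt0 m : 0 < s m - r m by have /andP[] := rs m; rewrite subr_gt0.
apply: (@euler_beta_ratio_unbounded (r 0) (r 1) (r 2)
   (s 1 ^+ 2 / ((s 0 - r 0) * (s 2 - r 2)))) => // N.
pose y m := euler_beta (r m) N.
pose U m := iter N bdiff (fun n => ((n%:R + r m) * (n%:R + s m))^-1) 0.
have bnd m : y m / s m <= U m <= y m / (s m - r m).
  by apply: iter_bdiff_inv_prod => //; case/andP: (rs m).
have y_gt0 m : 0 < y m by exact: euler_beta_gt0.
have U_gt0 m : 0 < U m.
  by have /andP[le _] := bnd m; apply: lt_le_trans le; rewrite divr_gt0.
have le1 : y 1%N ^+ 2 <= s 1%N ^+ 2 * U 1%N ^+ 2.
  rewrite -exprMn ler_sqr ?nnegrE ?mulr_ge0 ?(ltW (y_gt0 _)) ?(ltW (s_gt0 _))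
    ?(ltW (U_gt0 _)) //.
  by rewrite mulrC -ler_pdivrMr //; case/andP: (bnd 1%N).
apply: le_trans le1 _; rewrite -/(y 0%N) -/(y 2%N).
have -> : s 1 ^+ 2 / ((s 0 - r 0) * (s 2 - r 2)) * (y 0 * y 2)
   = s 1 ^+ 2 * ((y 0 / (s 0 - r 0)) * (y 2 / (s 2 - r 2))).
  by move: (y 0) (y 2) => u v; field; rewrite !gt_eqF.
rewrite ler_wpM2l ?sqr_ge0 //.
apply: le_trans (cm_seq_log_convex (cm N) (U_gt0 0)) _.
rewrite -/(U 0) -/(U 2) ler_pM ?(ltW (U_gt0 _)) //.
  by case/andP: (bnd 0).
by case/andP: (bnd 2).
Qed.

Lemma cm_seq_drop c k : cm_seq c -> cm_seq (fun n => c (n + k)%N).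
Proof.
move=> cc; elim: k => [|k IH].
  by rewrite (_ : (fun n => _) = c) //; apply: funext => n; rewrite addn0.
rewrite (_ : (fun n => _) = fun n => c (n.+1 + k)%N); first exact: cm_seq_shift IH.
by apply: funext => n; rewrite addnS.
Qed.

(** * Quadratics on the natural numbers *)

Lemma quadratic_eventually_gt (A B C M : R) : 0 < A \/ A = 0 /\ 0 < B ->
  exists K, forall m, (K <= m)%N -> M < A * m%:R ^+ 2 + B * m%:R + C.
Proof.
have arch (a t : R) : 0 < a -> exists K, forall m, (K <= m)%N -> `|t| < a * m%:R.
  move=> a0; exists (Num.bound (`|t| / a)) => m Km.
  rewrite -ltr_pdivrMl // mulrC.
  apply: lt_le_trans (archi_boundP _) _; first by rewrite divr_ge0 // ltW.
  by rewrite ler_nat.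
case=> [A0|[-> B0]].
  have [K HK] := arch A (`|B| + `|M - C|) A0.
  exists K.+1 => m Km; have := HK m (ltnW Km).
  have m1 : 1 <= m%:R :> R by rewrite ler1n (leq_trans _ Km).
  rewrite ger0_norm ?addr_ge0 //.
  have := ler_norm (M - C); have := normr_ge0 (M - C).
  have := ler_norm (- B); rewrite normrN; move: m1.
  move: (m%:R : R) `|B| `|M - C| => x b d x1 h1 h2 h3 h4.
  nra.
have [K HK] := arch B (M - C) B0; exists K => m Km; have := HK m Km.
have := ler_norm (M - C); rewrite mul0r; lra.
Qed.

Lemma quadratic_ge0_nat (A B C : R) :
  (forall m : nat, 0 <= A * m%:R ^+ 2 + B * m%:R + C) ->
  0 <= A /\ (A = 0 -> 0 <= B).
Proof.
move=> h.
have no : ~ (0 < - A \/ - A = 0 /\ 0 < - B).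
  move=> /(@quadratic_eventually_gt _ _ (- C) 0)[K /(_ K (leqnn K))].
  have := h K; lra.
split; first by rewrite leNgt; apply/negP => A0; apply: no; left; rewrite oppr_gt0.
move=> A0; rewrite leNgt; apply/negP => B0.
by apply: no; right; rewrite A0 oppr0 oppr_gt0.
Qed.

(** The [g i] stand for the square roots of three consecutive values of a
    quadratic with leading coefficient [A], whose second difference is
    [2 A].  Squaring [2 g1 <= g0 + g2] leaves [g1^2 - A <= g0 g2], with a
    nonnegative left-hand side. *)
Lemma sqrt_quadratic_convex (A g0 g1 g2 : R) :
  0 <= g0 -> 0 <= g1 -> 0 <= g2 -> A <= g1 ^+ 2 ->
  g0 ^+ 2 + g2 ^+ 2 = 2 * g1 ^+ 2 + 2 * A -> 2 * g1 <= g0 + g2 ->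
  (g1 ^+ 2 - A) ^+ 2 <= g0 ^+ 2 * g2 ^+ 2.
Proof.
move=> h0 h1 h2 hA e lt.
have sq : (2 * g1) ^+ 2 <= (g0 + g2) ^+ 2.
  by rewrite ler_sqr ?nnegrE ?mulr_ge0 ?addr_ge0.
rewrite -exprMn ler_sqr ?nnegrE ?mulr_ge0 ?subr_ge0 //; nra.
Qed.

End Sequences.

(** * Completely monotone nets in two variables *)

Section Nets.
Variable R : realType.
Implicit Types (f g : nat -> nat -> R) (m n N : nat).

Definition bdiff1 f := fun m n => f m n - f m.+1 n.
Definition bdiff2 f := fun m n => f m n - f m n.+1.

(** Complete monotonicity truncated at total order [N] of the differences.  The
    truncation makes closure properties provable by induction on [N], one
    application of a product or limit rule at a time. *)
Fixpoint cm_upto N f : Prop :=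
  (forall m n, 0 <= f m n) /\
  if N is N'.+1 then cm_upto N' (bdiff1 f) /\ cm_upto N' (bdiff2 f) else True.

Lemma cm_upto_ge0 N f m n : cm_upto N f -> 0 <= f m n.
Proof. by case: N => [|N] [h _]. Qed.

Lemma cm_upto_S N f : cm_upto N.+1 f -> cm_upto N f.
Proof.
elim: N f => [|N IH] f [f0 [f1 f2]]; first by split.
by split=> //; split; apply: IH.
Qed.

Lemma cm_upto_iter N i j f m n :
  cm_upto (N + i + j) f -> cm_upto N (iter i bdiff1 (iter j bdiff2 f)).
Proof.
elim: j f => [|j IH] f.
  rewrite addn0 /=; elim: i f => [|i IH] f; first by rewrite addn0.
  by rewrite addnS iterSr => -[_ [h _]]; apply: IH.
by rewrite addnS iterSr => -[_ [_ h]]; apply: IH.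
Qed.

Lemma cm_upto_cst N (a : R) : 0 <= a -> cm_upto N (fun _ _ => a).
Proof.
elim: N a => [|N IH] a a0; split=> //.
by rewrite /bdiff1 /bdiff2 subrr; split; apply: IH.
Qed.

Lemma cm_uptoD N f g : cm_upto N f -> cm_upto N g ->
  cm_upto N (fun m n => f m n + g m n).
Proof.
elim: N f g => [|N IH] f g.
  by move=> [f0 _] [g0 _]; split=> // m n; rewrite addr_ge0.
move=> [f0 [f1 f2]] [g0 [g1 g2]]; split; first by move=> m n; rewrite addr_ge0.
split.
- rewrite (_ : bdiff1 _ = fun m n => bdiff1 f m n + bdiff1 g m n); first exact: IH.
  by do 2!apply: funext => ?; rewrite /bdiff1; ring.
- rewrite (_ : bdiff2 _ = fun m n => bdiff2 f m n + bdiff2 g m n); first exact: IH.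
  by do 2!apply: funext => ?; rewrite /bdiff2; ring.
Qed.

Lemma cm_upto_shift N f : cm_upto N f ->
  cm_upto N (fun m n => f m.+1 n) /\ cm_upto N (fun m n => f m n.+1).
Proof.
elim: N f => [|N IH] f; first by move=> [f0 _]; split; split.
move=> [f0 [/IH[f11 f12] /IH[f21 f22]]].
by split; split.
Qed.

(** Leibniz rule [(fg)' = f g' + f' (shifted g)] and stability under shifts. *)
Lemma cm_uptoM N f g : cm_upto N f -> cm_upto N g ->
  cm_upto N (fun m n => f m n * g m n).
Proof.
elim: N f g => [|N IH] f g.
  by move=> [f0 _] [g0 _]; split=> // m n; rewrite mulr_ge0.
move=> cf cg; have [gs1 gs2] := cm_upto_shift (cm_upto_S cg).
have [f0 [f1 f2]] := cf; have [g0 [g1 g2]] := cg.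
have cf' := cm_upto_S cf.
split; first by move=> m n; rewrite mulr_ge0.
split.
- rewrite (_ : bdiff1 _ = fun m n =>
      f m n * bdiff1 g m n + bdiff1 f m n * g m.+1 n).
    by apply: cm_uptoD; apply: IH.
  by do 2!apply: funext => ?; rewrite /bdiff1; ring.
- rewrite (_ : bdiff2 _ = fun m n =>
      f m n * bdiff2 g m n + bdiff2 f m n * g m n.+1).
    by apply: cm_uptoD; apply: IH.
  by do 2!apply: funext => ?; rewrite /bdiff2; ring.
Qed.

(** A difference of the inverse of [L] is a nonnegative multiple of the product
    of the inverses of [L] and of its shift, which is a form of the same kind. *)
Lemma cm_upto_inv_linear N (a b c : R) : 0 <= a -> 0 <= b ->
  (forall m n : nat, 0 < c + a * m%:R + b * n%:R) ->
  cm_upto N (fun m n => (c + a * m%:R + b * n%:R)^-1).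
Proof.
move=> a0 b0; elim: N c => [|N IH] c pos.
  by split=> // m n; rewrite invr_ge0 ltW.
split; first by move=> m n; rewrite invr_ge0 ltW.
split.
- rewrite (_ : bdiff1 _ = fun m n => a * ((c + a * m%:R + b * n%:R)^-1 *
     (c + a + a * m%:R + b * n%:R)^-1)).
    apply: cm_uptoM; first exact: cm_upto_cst.
    apply: cm_uptoM; apply: IH => // m n.
    by have := pos m.+1 n; rewrite -natr1 mulrDr mulr1; congr (0 < _); ring.
  apply: funext => m; apply: funext => n; rewrite /bdiff1 -natr1.
  have := pos m n; have := pos m.+1 n; rewrite -natr1 => h1 h2.
  by field; rewrite !gt_eqF //; move: h1; rewrite mulrDr mulr1; congr (0 < _); ring.
- rewrite (_ : bdiff2 _ = fun m n => b * ((c + a * m%:R + b * n%:R)^-1 *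
     (c + b + a * m%:R + b * n%:R)^-1)).
    apply: cm_uptoM; first exact: cm_upto_cst.
    apply: cm_uptoM; apply: IH => // m n.
    by have := pos m n.+1; rewrite -natr1 mulrDr mulr1; congr (0 < _); ring.
  apply: funext => m; apply: funext => n; rewrite /bdiff2 -natr1.
  have := pos m n; have := pos m n.+1; rewrite -natr1 => h1 h2.
  by field; rewrite !gt_eqF //; move: h1; rewrite mulrDr mulr1; congr (0 < _); ring.
Qed.

Local Open Scope classical_set_scope.

Lemma cm_upto_lim N (S : nat -> nat -> nat -> R) f :
  (forall K, cm_upto N (S K)) ->
  (forall m n, (fun K => S K m n) @ \oo --> f m n) -> cm_upto N f.
Proof.
have ge0 (T : nat -> nat -> nat -> R) h : (forall K m n, 0 <= T K m n) ->
    (forall m n, (fun K => T K m n) @ \oo --> h m n) -> forall m n, 0 <= h m n.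
  move=> T0 Th m n; rewrite -(cvg_lim _ (Th m n)) //.
  by apply: limr_ge; [apply/cvg_ex; exists (h m n)|exact: nearW].
elim: N S f => [|N IH] S f cS Sf.
  by split=> //; apply: ge0 Sf => K m n; exact: cm_upto_ge0 (cS K).
split; first by apply: ge0 Sf => K m n; exact: cm_upto_ge0 (cS K).
split.
- apply: (IH (fun K => bdiff1 (S K))); first by move=> K; case: (cS K) => _ [].
  by move=> m n; apply: cvgB; apply: Sf.
- apply: (IH (fun K => bdiff2 (S K))); first by move=> K; case: (cS K) => _ [].
  by move=> m n; apply: cvgB; apply: Sf.
Qed.

(** With [g = 1 / (f + k)], the inverse of [f] is the sum of the geometric
    series of the [k^j g^(j+1)], whose partial sums satisfy
    [S_(K+1) = g (1 + k S_K)]. *)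
Lemma cm_upto_inv_sub N f (k : R) : 0 <= k -> (forall m n, 0 < f m n) ->
  cm_upto N (fun m n => (f m n + k)^-1) -> cm_upto N (fun m n => (f m n)^-1).
Proof.
move=> k0 f0 cg.
have fk m n : 0 < f m n + k by rewrite ltr_wpDr.
pose rho m n := k / (f m n + k).
have rhoE m n : 0 <= rho m n < 1.
  by rewrite divr_ge0 ?(ltW (fk _ _)) //= ltr_pdivrMr // mul1r ltrDr.
pose S K m n := (1 - rho m n ^+ K) / f m n.
apply: (@cm_upto_lim _ S).
- elim=> [|K IH].
    rewrite (_ : S 0%N = fun _ _ => 0); first exact: cm_upto_cst.
    by do 2!apply: funext => ?; rewrite /S expr0 subrr mul0r.
  rewrite (_ : S K.+1 = fun m n => (f m n + k)^-1 * (1 + k * S K m n)).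
    apply: cm_uptoM => //; apply: cm_uptoD; first exact: cm_upto_cst.
    by apply: cm_uptoM => //; exact: cm_upto_cst.
  apply: funext => m; apply: funext => n; rewrite /S exprS.
  move: (rho m n ^+ K) => t; rewrite /rho.
  by field; rewrite !gt_eqF.
- move=> m n.
  suff : (fun K => (1 - rho m n ^+ K) / f m n) @ \oo --> (1 - 0) / f m n.
    by rewrite subr0 mul1r.
  apply: (@cvgMr_tmp _ _ _ _ (fun K => 1 - rho m n ^+ K)).
  apply: cvgB; first exact: cvg_cst.
  by apply: cvg_expr; have /andP[r0 r1] := rhoE m n; rewrite ger0_norm.
Qed.

Local Close Scope classical_set_scope.

(** * Joint complete monotonicity through backward differences *)

Definition cm_net2 f := forall i j m n, 0 <= iter i bdiff1 (iter j bdiff2 f) m n.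

Lemma fdiff_net2_1 f : fdiff ord0 (net2 f) = net2 (fun m n => - bdiff1 f m n).
Proof.
apply: funext => al; rewrite /fdiff /net2 /add_mi /unit_mi !ffunE /= addn1 addn0.
by rewrite /bdiff1 opprB.
Qed.

Lemma fdiff_net2_2 f :
  fdiff (lift ord0 ord0) (net2 f) = net2 (fun m n => - bdiff2 f m n).
Proof.
apply: funext => al; rewrite /fdiff /net2 /add_mi /unit_mi !ffunE /= addn1 addn0.
by rewrite /bdiff2 opprB.
Qed.

Lemma iter_fdiff_net2_1 f i :
  iter i (fdiff ord0) (net2 f) = net2 (fun m n => (-1) ^+ i * iter i bdiff1 f m n).
Proof.
elim: i => [|i IH] /=.
  by congr net2; do 2!apply: funext => ?; rewrite mul1r.
rewrite IH fdiff_net2_1; congr net2; do 2!apply: funext => ?.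
by rewrite /bdiff1 exprS; ring.
Qed.

Lemma iter_fdiff_net2_2 f j :
  iter j (fdiff (lift ord0 ord0)) (net2 f)
    = net2 (fun m n => (-1) ^+ j * iter j bdiff2 f m n).
Proof.
elim: j => [|j IH] /=.
  by congr net2; do 2!apply: funext => ?; rewrite mul1r.
rewrite IH fdiff_net2_2; congr net2; do 2!apply: funext => ?.
by rewrite /bdiff2 exprS; ring.
Qed.

Lemma iter_bdiff1Z i (a : R) f m n :
  iter i bdiff1 (fun m n => a * f m n) m n = a * iter i bdiff1 f m n.
Proof. by elim: i m n => //= i IH m n; rewrite /bdiff1 !IH mulrBr. Qed.

Lemma mfdiff_net2 (beta al : multiindex 2) f :
  (-1) ^+ deg_mi beta * mfdiff beta (net2 f) al =
  iter (beta ord0) bdiff1 (iter (beta ord_max) bdiff2 f) (al ord0) (al ord_max).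
Proof.
have l2 : lift ord0 ord0 = ord_max :> 'I_2 by apply: val_inj.
rewrite /mfdiff /deg_mi !big_ord_recl !big_ord0 addn0 /comp.
rewrite iter_fdiff_net2_2 iter_fdiff_net2_1 {1}/net2 iter_bdiff1Z l2.
by rewrite !mulrA -!exprD -addnA addnn -mul2n exprM sqrrN !expr1n mul1r.
Qed.

Lemma jcm_net2P f : joint_completely_monotone (net2 f) <-> cm_net2 f.
Proof.
split=> [h i j m n|h al be]; last by rewrite mfdiff_net2.
have := h [ffun k => if k == ord0 then m else n]
  [ffun k => if k == ord0 then i else j].
by rewrite mfdiff_net2 !ffunE.
Qed.

Lemma cm_upto_jcm f : (forall N, cm_upto N f) -> joint_completely_monotone (net2 f).
Proof.
move=> cf; apply/jcm_net2P => i j m n.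
by apply: (@cm_upto_ge0 0); apply: cm_upto_iter.
Qed.

Lemma iter_bdiff1E i f m n : iter i bdiff1 f m n = iter i (@bdiff R) (f^~ n) m.
Proof. by elim: i m => //= i IH m; rewrite /bdiff1 !IH. Qed.

Lemma iter_bdiff2E j f m n : iter j bdiff2 f m n = iter j (@bdiff R) (f m) n.
Proof. by elim: j n => //= j IH n; rewrite /bdiff2 !IH. Qed.

Lemma cm_net2_seq f j n : cm_net2 f -> cm_seq (fun m => iter j (@bdiff R) (f m) n).
Proof.
move=> cf i m; have := cf i j m n; rewrite iter_bdiff1E.
by under eq_fun do rewrite iter_bdiff2E.
Qed.

Lemma cm_net2_row f m : cm_net2 f -> cm_seq (f m).
Proof. by move=> cf j n; exact: cm_net2_seq cf 0 m. Qed.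

End Nets.

(** * The quadratic polynomial *)

Section Quadratic.
Variables (R : realType) (a0 a1 a2 b0 b1 : R).
Let p (m n : nat) := quad_p a0 a1 a2 b0 b1 m%:R n%:R.
Hypothesis p_gt0 : forall m n, 0 < p m n.

(** Coefficients in [x] of the discriminant of [quad_p] as a polynomial in [y]. *)
Definition discr2 := b0 ^+ 2 - 4 * a0.
Definition discr1 := 2 * b0 ^+ 2 * b1 - 4 * a0 * (a1 + a2).
Definition discr0 := b0 ^+ 2 * b1 ^+ 2 - 4 * a0 * a1 * a2.

Lemma discrE x :
  bcoef b0 b1 x ^+ 2 - 4 * acoef a0 a1 a2 x
    = discr2 * x ^+ 2 + discr1 * x + discr0.
Proof. rewrite /bcoef /acoef /discr2 /discr1 /discr0; ring. Qed.

Lemma discr_discrE :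
  discr1 ^+ 2 - 4 * discr2 * discr0
    = 16 * a0 * (a0 * (a2 - a1) ^+ 2 - b0 ^+ 2 * (b1 - a1) * (a2 - b1)).
Proof. rewrite /discr2 /discr1 /discr0; ring. Qed.

Lemma a0_gt0 : 0 < a0.
Proof.
have pE (m : nat) : p m 0 = a0 * m%:R ^+ 2 + a0 * (a1 + a2) * m%:R + a0 * a1 * a2.
  by rewrite /p /quad_p /acoef; ring.
have [] := @quadratic_ge0_nat R a0 (a0 * (a1 + a2)) (a0 * a1 * a2).
  by move=> m; rewrite -pE ltW.
rewrite le_eqVlt => /predU1P[a00|//] _.
by have := p_gt0 0 0; rewrite pE -a00 !mul0r !addr0 ltxx.
Qed.

(** A discriminant of the form [(sx + e)^2 + 4k] with [k >= 0] gives
    [p + k = L1 L2]. *)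
Lemma jcm_of_discr : 0 < b0 -> 0 < b1 -> 0 <= discr2 ->
  discr1 ^+ 2 <= 4 * discr2 * discr0 ->
  joint_completely_monotone (net2 (fun m n => (p m n)^-1)).
Proof.
move=> b0_gt0 b1_gt0 A_ge0 BAC.
pose s := Num.sqrt discr2.
have s_ge0 : 0 <= s by exact: sqrtr_ge0.
have sE : s ^+ 2 = discr2 by rewrite sqr_sqrtr.
have s_le : s <= b0.
  rewrite -ler_sqr ?nnegrE ?(ltW b0_gt0) // sE /discr2 gerBl.
  by rewrite mulr_ge0 // ltW // a0_gt0.
have [e [k [k_ge0 BE CE]]] : exists e k,
    [/\ 0 <= k, discr1 = 2 * s * e & discr0 = e ^+ 2 + 4 * k].
  (* If the leading coefficient is zero, so is the middle one; then [b1] is the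
     midpoint of [a1] and [a2], and the constant that remains is a square. *)
  move: A_ge0; rewrite le_eqVlt => /predU1P[A0|A_gt0].
    have B0 : discr1 = 0.
      apply/eqP; rewrite -sqrf_eq0 eq_le sqr_ge0 andbT.
      by rewrite (le_trans BAC) // -A0 mulr0 mul0r.
    have C_ge0 : 0 <= discr0.
      have aE : 4 * a0 = b0 ^+ 2 by apply/esym/eqP; rewrite -subr_eq0 -/discr2 -A0.
      have bE : b1 = (a1 + a2) / 2.
        have : b0 ^+ 2 * (2 * b1 - (a1 + a2)) = 0 by rewrite -B0 /discr1 -aE; ring.
        move/eqP; rewrite mulf_eq0 sqrf_eq0 gt_eqF //= subr_eq0.
        by move=> /eqP <-; field.
      have -> : discr0 = b0 ^+ 2 * ((a2 - a1) / 2) ^+ 2.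
        by rewrite /discr0 aE bE; field.
      by rewrite mulr_ge0 // sqr_ge0.
    exists 0, (discr0 / 4); split; first by rewrite divr_ge0.
      by rewrite B0 mulr0.
    by field.
  have s_gt0 : 0 < s by rewrite sqrtr_gt0.
  exists (discr1 / (2 * s)), ((discr0 - (discr1 / (2 * s)) ^+ 2) / 4); split.
  - rewrite divr_ge0 // subr_ge0 expr_div_n exprMn sE.
    rewrite ler_pdivrMr ?mulr_gt0 ?exprn_gt0 //.
    by apply: le_trans BAC _; rewrite le_eqVlt; apply/orP; left; apply/eqP; ring.
  - by field; rewrite gt_eqF.
  - by field; rewrite gt_eqF.
pose L1 (m n : nat) := (b0 * b1 - e) / 2 + (b0 - s) / 2 * m%:R + 1 * n%:R.
pose L2 (m n : nat) := (b0 * b1 + e) / 2 + (b0 + s) / 2 * m%:R + 1 * n%:R.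
have LE m n : p m n + k = L1 m n * L2 m n.
  have : 4 * (p m n) + 4 * k = 4 * (L1 m n * L2 m n).
    have -> : 4 * p m n = (2 * n%:R + bcoef b0 b1 m%:R) ^+ 2
        - (bcoef b0 b1 m%:R ^+ 2 - 4 * acoef a0 a1 a2 m%:R)
      by rewrite /p /quad_p; ring.
    by rewrite discrE BE CE -sE /L1 /L2 /bcoef; field.
  lra.
have L_gt0 m n : 0 < L1 m n /\ 0 < L2 m n.
  have prod_gt0 : 0 < L1 m n * L2 m n by rewrite -LE ltr_wpDr.
  have sum_gt0 : 0 < L1 m n + L2 m n.
    have -> : L1 m n + L2 m n = b0 * (m%:R + b1) + 2 * n%:R
      by rewrite /L1 /L2; field.
    by rewrite ltr_wpDr // ?mulr_ge0 // mulr_gt0 // ltr_wpDl.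
  by move: (L1 m n) (L2 m n) prod_gt0 sum_gt0 => x y; nra.
apply: cm_upto_jcm => N; apply: (cm_upto_inv_sub k_ge0) => //.
rewrite (_ : (fun m n => _) = fun m n => (L1 m n)^-1 * (L2 m n)^-1); last first.
  by do 2!apply: funext => ?; rewrite LE invfM.
apply: cm_uptoM; apply: cm_upto_inv_linear => //.
- by rewrite divr_ge0 // subr_ge0.
- by move=> m n; case: (L_gt0 m n).
- by rewrite divr_ge0 // addr_ge0 // ltW.
- by move=> m n; case: (L_gt0 m n).
Qed.

Section Necessity.
Hypothesis cm : cm_net2 (fun m n => (p m n)^-1).

(** The column [n = 0] is the inverse of [a0 (m + a1) (m + a2)]. *)
Lemma cm_a_gt0 : a1 <= a2 -> 0 < a1 /\ 0 < a2.
Proof.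
move=> a12.
have pE (m : nat) : p m 0 = a0 * (a1 * a2 + (a1 + a2) * m%:R + m%:R ^+ 2).
  by rewrite /p /quad_p /acoef; ring.
have q_gt0 (m : nat) : 0 < a1 * a2 + (a1 + a2) * m%:R + m%:R ^+ 2.
  by have := p_gt0 m 0; rewrite pE pmulr_rgt0 // a0_gt0.
have [] := cm_seq_inv_quadratic q_gt0.
  move=> k n.
  rewrite (_ : (fun m : nat => _) = fun m => a0 * (p m 0)^-1).
    by rewrite iter_bdiffZ mulr_ge0 ?(ltW a0_gt0) //; exact: (cm_net2_seq 0 0 cm).
  by apply: funext => m; rewrite pE invfM mulVKf // gt_eqF // a0_gt0.
have := q_gt0 0; nra.
Qed.

Lemma cm_row m :
  0 < bcoef b0 b1 m%:R /\ 0 <= discr2 * m%:R ^+ 2 + discr1 * m%:R + discr0.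
Proof.
rewrite -discrE subr_ge0.
exact: (cm_seq_inv_quadratic (p_gt0 m) (cm_net2_row m cm)).
Qed.

Lemma cm_b_gt0 : 0 < b0 /\ 0 < b1.
Proof.
have b_ge0 : 0 <= b0.
  have [] := @quadratic_ge0_nat R 0 b0 (b0 * b1); last by move=> _; apply.
  by move=> m; have [/ltW] := cm_row m; rewrite /bcoef mul0r add0r mulrDr.
have [] := cm_row 0; rewrite /bcoef add0r => h _.
have b0_gt0 : 0 < b0.
  by rewrite lt_def b_ge0 andbT; apply: contraTneq h => ->; rewrite mul0r ltxx.
by split=> //; rewrite -(pmulr_rgt0 _ b0_gt0).
Qed.

Lemma cm_discr2_ge0 : 0 <= discr2.
Proof. by have [] := quadratic_ge0_nat (fun m => proj2 (cm_row m)). Qed.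

(** If it failed, the discriminant would tend to infinity, so that far enough
    out the rows have two distinct roots and [small_root_concave] applies. *)
Lemma cm_discr_discr_le0 : discr1 ^+ 2 <= 4 * discr2 * discr0.
Proof.
rewrite leNgt; apply/negP => lt.
pose D (m : nat) := discr2 * m%:R ^+ 2 + discr1 * m%:R + discr0.
have [A_ge0 AB] := quadratic_ge0_nat (fun m => proj2 (cm_row m)).
have AB' : 0 < discr2 \/ discr2 = 0 /\ 0 < discr1.
  move: A_ge0; rewrite le_eqVlt => /predU1P[A0|]; last by left.
  right; split=> //; rewrite lt_def AB // andbT -sqrf_eq0 gt_eqF //.
  by apply: le_lt_trans lt; rewrite -A0 mulr0 mul0r.
have [K HK] := quadratic_eventually_gt discr0 discr2 AB'.
have D_gt m : discr2 < D (m + K)%N by apply: HK; rewrite leq_addl.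
have D_gt0 m : 0 < D (m + K)%N by apply: le_lt_trans (D_gt m).
pose b (m : nat) := bcoef b0 b1 (m + K)%:R.
pose g m := Num.sqrt (D (m + K)%N).
have gE m : g m ^+ 2 = D (m + K)%N by rewrite sqr_sqrtr // ltW.
have g_gt0 m : 0 < g m by rewrite sqrtr_gt0.
pose r m := (b m - g m) / 2; pose s m := (b m + g m) / 2.
have pE m n : p (m + K)%N n = (n%:R + r m) * (n%:R + s m).
  have -> : (n%:R + r m) * (n%:R + s m)
      = n%:R ^+ 2 + b m * n%:R + (b m ^+ 2 - g m ^+ 2) / 4 by rewrite /r /s; field.
  by rewrite gE /D -discrE /p /quad_p /b; field.
have rs m : 0 < r m < s m.
  have [b_gt0 _] := cm_row (m + K)%N; rewrite -/(b m) in b_gt0.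
  have s_gt0 : 0 < s m by rewrite divr_gt0 // addr_gt0.
  have := p_gt0 (m + K)%N 0; rewrite pE !add0r pmulr_lgt0 // => -> /=.
  by rewrite ltr_pM2r ?invr_gt0 // ltrD2l gt0_cp.
have : r 0 + r 2 <= 2 * r 1.
  apply: (small_root_concave rs) => N.
  have := cm_seq_drop K (cm_net2_seq N 0 cm).
  by under eq_fun do under eq_fun do rewrite pE.
have bE : b 0 + b 2 = 2 * b 1 by rewrite /b /bcoef !natrD; ring.
have DE : g 0 ^+ 2 + g 2 ^+ 2 = 2 * g 1 ^+ 2 + 2 * discr2.
  by rewrite !gE /D !natrD; ring.
move=> rc.
have conv : 2 * g 1 <= g 0 + g 2 by move: rc; rewrite /r; lra.
have A_le : discr2 <= g 1 ^+ 2 by rewrite gE ltW.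
have g_ge0 m : 0 <= g m by exact: ltW.
have := sqrt_quadratic_convex (g_ge0 0) (g_ge0 1) (g_ge0 2) A_le DE conv.
rewrite !gE leNgt -subr_gt0 => /negP; apply.
have -> : (D (1 + K)%N - discr2) ^+ 2 - D (0 + K)%N * D (2 + K)%N
    = discr1 ^+ 2 - 4 * discr2 * discr0.
  by rewrite /D !natrD; ring.
by rewrite subr_gt0.
Qed.

End Necessity.
End Quadratic.

Theorem theorem3p1 (R : realType) (a0 a1 a2 b0 b1 : R)
    (a1_le_a2 : a1 <= a2)
    (p_gt0 : forall m n : nat, 0 < quad_p a0 a1 a2 b0 b1 m%:R n%:R) :
  joint_completely_monotone
    (net2 (fun m n : nat => 1 / quad_p a0 a1 a2 b0 b1 m%:R n%:R))
  <->
  [/\ [/\ 0 < a1, 0 < a2, 0 < b0 & 0 < b1],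
      b0 ^+ 2 >= 4 * a0 &
      a0 * (a2 - a1) ^+ 2 <= b0 ^+ 2 * (b1 - a1) * (a2 - b1)].
Proof.
under eq_fun do under eq_fun do rewrite div1r.
have a0_gt0 := a0_gt0 p_gt0.
have discr := discr_discrE a0 a1 a2 b0 b1.
split.
  move=> /jcm_net2P cm.
  have [a1_gt0 a2_gt0] := cm_a_gt0 p_gt0 cm a1_le_a2.
  have [b0_gt0 b1_gt0] := cm_b_gt0 p_gt0 cm.
  split=> //; first by rewrite -subr_ge0; exact: cm_discr2_ge0 cm.
  have := cm_discr_discr_le0 p_gt0 cm.
  by rewrite -subr_le0 discr pmulr_rle0 ?mulr_gt0 // subr_le0.
move=> [[_ _ b0_gt0 b1_gt0] A_ge0 le].
apply: jcm_of_discr => //; first by rewrite subr_ge0.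
by rewrite -subr_le0 discr pmulr_rle0 ?mulr_gt0 // subr_le0.
Qed.
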